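(* Let $\alpha$ be a countable order type (of a chain). The join-semilattice $[\omega]^{<\omega}$ is minimal in $\mathbb{J}_{\alpha}$ if and only if $\alpha$ is not an ordinal.
   Context: $\mathbb{J}$ is the class of join-semilattices having a least element. An ideal of a poset $P$ is a non-empty up-directed initial segment (down-closed subset); $J(P)$ is the set of ideals of $P$ ordered by inclusion. $I(\alpha)$ is the order type of the chain of all initial segments (including the empty one and the whole chain), ordered by inclusion, of a chain of type $\alpha$. $\mathbb{J}_{\alpha}$ is the class of $P\in\mathbb{J}$ such that $J(P)$ contains a chain of type $I(\alpha)$. $[\omega]^{<\omega}$ is the set of finite subsets of $\omega$ ordered by inclusion; for countable $\alpha$ it belongs to $\mathbb{J}_\alpha$. $\mathbb{J}$ is quasi-ordered by: $P\leq P'$ if $P$ is isomorphic to a join-subsemilattice of $P'$ (a subset closed under binary joins, with the induced order). A member $M$ of $\mathbb{J}_\alpha$ is minimal in $\mathbb{J}_{\alpha}$ if for every $P\in \mathbb{J}_{\alpha}$ with $P\leq M$ one has $M\leq P$. An order type is an ordinal if it is the order type of a well-ordered chain. *)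

(* Defs.v *)
From HB Require Import structures.
From mathcomp Require Import all_boot all_order finmap all_classical.
From mathcomp Require wochoice.

Set Implicit Arguments.
Unset Strict Implicit.
Unset Printing Implicit Defensive.

Import Order.TTheory.
Local Open Scope order_scope.
Local Open Scope classical_set_scope.

(* finmap declares no order on {fset K}; it is made here into a
   join-semilattice with least element for inclusion. *)
Fact fset_incl_display : Order.disp_t. Proof. exact: Order.Disp tt tt. Qed.

Section FsetInclusion.
Variable K : choiceType.
Implicit Types A B C : {fset K}.

Let fle A B := fsubset A B.

Fact fset_incl_refl : reflexive fle.
Proof. exact: fsubset_refl. Qed.

Fact fset_incl_anti : antisymmetric fle.
Proof. by move=> A B AB; apply/eqP; rewrite eqEfsubset. Qed.

Fact fset_incl_trans : transitive fle.
Proof. by move=> B A C; exact: fsubset_trans. Qed.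

HB.instance Definition _ :=
  Order.Le_isPOrder.Build fset_incl_display {fset K}
    fset_incl_refl fset_incl_anti fset_incl_trans.

Fact fset_incl_leUx A B C :
  (fsetU A B <= C :> {fset K}) = (A <= C) && (B <= C).
Proof. exact: fsubUset. Qed.

HB.instance Definition _ :=
  Order.POrder_isJoinSemilattice.Build fset_incl_display {fset K}
    fset_incl_leUx.

Fact fset_incl_le0x A : (fset0 : {fset K}) <= A.
Proof. exact: fsub0set. Qed.

HB.instance Definition _ :=
  Order.hasBottom.Build fset_incl_display {fset K} fset_incl_le0x.

End FsetInclusion.

(* A and B carry the orders induced by T1 and T2. The function f is total on T1,
   which costs nothing below, where T2 is always inhabited. *)
Definition order_isomorphic d1 (T1 : porderType d1) d2 (T2 : porderType d2)
    (A : set T1) (B : set T2) : Prop :=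
  exists f : T1 -> T2,
    set_bij A B f /\ {in A &, {mono f : x y / x <= y}}.

Definition initial_segment d (P : porderType d) (A : set P) : Prop :=
  forall x y, A y -> x <= y -> A x.

Definition up_directed d (P : porderType d) (A : set P) : Prop :=
  forall x y, A x -> A y -> exists z, [/\ A z, x <= z & y <= z].

Definition ideal d (P : porderType d) (A : set P) : Prop :=
  [/\ A !=set0, up_directed A & initial_segment A].

(* The orders on I(T) and J(P) are those induced by [set T] and [set P],
   whose library order is inclusion. *)
Definition initial_segments d (T : porderType d) : set (set T) :=
  [set A | initial_segment A].
Arguments initial_segments {d} T.

Definition ideals d (P : porderType d) : set (set P) := [set A | ideal A].
Arguments ideals {d} P.

(* The order type alpha is given by a chain T of type alpha. *)
Definition in_J d (T : orderType d) d' (P : bJoinSemilatticeType d') : Prop :=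
  exists C : set (set P),
    [/\ C `<=` ideals P,
        total_on C (fun A B => A <= B) &
        order_isomorphic (initial_segments T) C].

Definition join_subsemilattice d (P : bJoinSemilatticeType d) (S : set P) :
    Prop :=
  forall x y, S x -> S y -> S (Order.join x y).

(* S need not contain the least element of P'. *)
Definition embeds d (P : bJoinSemilatticeType d)
    d' (P' : bJoinSemilatticeType d') : Prop :=
  exists S : set P', join_subsemilattice S /\ order_isomorphic [set: P] S.

(* The choice structure packed in bJoinSemilatticeType is no restriction on P:
   classically every type carries one. *)
Definition minimal_in_J d (T : orderType d)
    d' (M : bJoinSemilatticeType d') : Prop :=
  in_J T M /\
  forall (d'' : Order.disp_t) (P : bJoinSemilatticeType d''),
    in_J T P -> embeds P M -> embeds M P.

Definition is_ordinal d (T : orderType d) : Prop :=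
  wochoice.well_order (<=%O : rel T).

Definition finite_subsets_omega : bJoinSemilatticeType fset_incl_display :=
  {fset nat}.

(* Main.v *)
(** Enumerate the chain by [e : T -> nat].  If the chain is not well ordered, a
    strictly decreasing sequence of initial segments yields a strictly
    decreasing sequence of ideals [J n] of any [P] under consideration.  Since
    [P] consists of finite sets of integers, each [J n] has a member [x n]
    owning a point [y n] covered by no member of [J n.+1]; thinning out makes
    [y n] private to [x n], and finite joins of the [x n] copy the finite
    subsets of [nat] into [P].  If the chain is an ordinal, let [P] consist of
    the finite initial segments of its sierpinskization (the intersection of
    its order with that of [nat]): the same private points, taken for the tails
    of a hypothetical copy of the finite subsets of [nat], would form a bad
    sequence in the sierpinskization, which is well-quasi-ordered. *)
Require Import Defs.
From HB Require Import structures.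
From mathcomp Require Import all_boot all_order finmap all_classical.
From mathcomp Require wochoice.

Set Implicit Arguments.
Unset Strict Implicit.
Unset Printing Implicit Defensive.

Import Order.TTheory.
Local Open Scope fset_scope.
Local Open Scope order_scope.
Local Open Scope classical_set_scope.

Lemma subsetOE (U : Type) (A B : set U) : (A <= B)%O <-> A `<=` B.
Proof. by rewrite subsetEset. Qed.

Lemma fset_leP (A B : {fset nat}) :
  reflect (forall a, a \in A -> a \in B) (A <= B)%O.
Proof. exact: fsubsetP. Qed.

(** The join of [f x] and [f y] stays in [S], so it is some [f z]; this [z] bounds [x] and [y] from
    above, which gives the hard inequality. *)
Lemma order_isomorphic_join d (P : bJoinSemilatticeType d)
    d' (Q : bJoinSemilatticeType d') (S : set Q) (f : P -> Q) :
  join_subsemilattice S -> set_bij [set: P] S f ->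
  {in [set: P] &, {mono f : x y / x <= y}} ->
  {mono f : x y / x <= y} /\ {morph f : x y / Order.join x y}.
Proof.
move=> Sj [fS _ Sf] fm; have {}fm : {mono f : x y / x <= y}.
  by move=> x y; apply: fm; rewrite in_setT.
split=> // x y; apply/eqP; rewrite eq_le leUx !fm leUl leUr !andbT.
have [z _ zE] := Sf _ (Sj _ _ (fS x I) (fS y I)).
by rewrite -zE fm leUx -!fm zE leUl leUr.
Qed.

Lemma injective_seq_escapes (y : nat -> nat) (s : seq nat) :
  injective y -> exists N, forall j, N <= j -> y j \notin s.
Proof.
move=> yI; elim: s => [|a s [N HN]]; first by exists 0%N.
have [[j0 j0E]|nj] := pselect (exists j, y j = a).
  exists (maxn N j0.+1) => j; rewrite leEnat geq_max => /andP[/HN yj j0j].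
  rewrite inE negb_or yj andbT -j0E (inj_eq yI).
  by rewrite neq_ltn j0j orbT.
exists N => j /HN yj; rewrite inE negb_or yj andbT.
by apply/eqP => yja; apply: nj; exists j.
Qed.

(** * Private points, and copies of the finite subsets of the integers *)

Section JoinEmbeddingInFiniteSets.
Variables (d : Order.disp_t) (P : bJoinSemilatticeType d).
Variable f : P -> {fset nat}.
Hypothesis f_mono : {mono f : x y / x <= y}.
Hypothesis f_join : {morph f : x y / Order.join x y >-> x `|` y}%fset.

(** Directedness turns separate coverings of finitely many points into one. Taking [f x] for [s], an
    [x] whose points are all covered by [J] lies in [J]. *)
Lemma ideal_cover (J : set P) (s : seq nat) : ideal J ->
  (forall y, y \in s -> exists2 z, J z & y \in f z) ->
  exists2 z, J z & forall y, y \in s -> y \in f z.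
Proof.
move=> [[p Jp] Jd _]; elim: s => [|a s IH] Hs; first by exists p.
have [|z Jz Hz] := IH; first by move=> y ys; apply: Hs; rewrite inE ys orbT.
have [w Jw aw] := Hs a (mem_head _ _).
have [v [Jv zv wv]] := Jd _ _ Jz Jw; exists v => // y.
rewrite inE => /orP[/eqP->|/Hz].
  by move: wv; rewrite -f_mono => /fset_leP; apply.
by move: zv; rewrite -f_mono => /fset_leP; apply.
Qed.

Variable J : nat -> set P.
Hypothesis J_ideal : forall n, ideal (J n).
Hypothesis J_decr : forall n, J n.+1 `<=` J n.
Hypothesis J_strict : forall n, ~ (J n `<=` J n.+1).

Lemma J_nonincreasing m n : (m <= n)%N -> J n `<=` J m.
Proof.
move=> /subnK <-; elim: (n - m)%N => [|k IH] //.
by apply: subset_trans IH; rewrite addSn; apply: J_decr.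
Qed.

(** Choose [x n] in [J n] outside [J n.+1]. Some point of [f (x n)] escapes every member of
    [J n.+1]: otherwise a single member would contain [f (x n)], and down-closure would put [x n] in
    [J n.+1]. *)
Lemma private_points : exists (x : nat -> P) (y : nat -> nat),
  [/\ forall n, J n (x n), forall n, y n \in f (x n), injective y
    & forall m n, (m < n)%N -> forall z, J n z -> y m \notin f z].
Proof.
have /choice[xy xyP] : forall n, exists p : P * nat,
    [/\ J n p.1, p.2 \in f p.1 & forall z, J n.+1 z -> p.2 \notin f z].
  move=> n; have [x [Jx nJx]] : exists x, J n x /\ ~ J n.+1 x.
    apply: contrapT => H; apply: (@J_strict n) => x Jx.
    by apply: contrapT => nJx; apply: H; exists x.
  apply: contrapT => H; apply: nJx.
  have [|z Jz xz] := @ideal_cover (J n.+1) (f x) (J_ideal _).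
    move=> y yx; apply: contrapT => nz; apply: H; exists (x, y); split=> //= z Jz.
    by apply/negP => yz; apply: nz; exists z.
  have [_ _ Jdown] := J_ideal n.+1; apply: (Jdown _ _ Jz).
  by rewrite -f_mono; apply/fset_leP.
pose x n := (xy n).1; pose y n := (xy n).2.
have xJ n : J n (x n) by case: (xyP n).
have yx n : y n \in f (x n) by case: (xyP n).
have yJ m n : (m < n)%N -> forall z, J n z -> y m \notin f z.
  by move=> mn z Jz; case: (xyP m) => _ _; apply; apply: J_nonincreasing Jz.
exists x, y; split=> // m n yE; apply/eqP; apply/negPn/negP; rewrite neq_ltn.
by case/orP => /yJ /(_ _ (xJ _)); rewrite ?yE ?yx // -yE yx.
Qed.

Lemma notin_join (y : nat) (s : seq nat) (x : nat -> P) :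
  y \notin f \bot -> (forall i, i \in s -> y \notin f (x i)) ->
  y \notin f (\join_(i <- s) x i).
Proof.
move=> y0 ys; rewrite big_seq.
elim/big_rec: _ => // i p /ys yi yp.
by rewrite f_join in_fsetU negb_or yi yp.
Qed.

Lemma finite_subsets_omega_embeds : embeds finite_subsets_omega P.
Proof.
have [x [y [xJ yx yI yJ]]] := private_points.
(* So far [y m] avoids only the later [x n]. As [f (x n)] is finite, it also misses [y j] from some
   rank [N n] on; iterating [N] makes privacy two-sided. *)
have /choice[N NP] : forall n, exists N : nat,
    (n < N)%N /\ forall j, (N <= j)%N -> y j \notin f (x n).
  move=> n; have [N HN] := injective_seq_escapes (f (x n)) yI.
  exists (maxn N n.+1); split; first by rewrite leq_max leqnn orbT.
  by move=> j; rewrite geq_max => /andP[/HN].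
pose g k := iter k N 0%N.
have gS k : g k.+1 = N (g k) by [].
have g_lt i j : (i < j)%N -> (N (g i) <= g j)%N.
  elim: j => // j IH; rewrite ltnS leq_eqVlt => /orP[/eqP->//|/IH H].
  by rewrite gS; apply: leq_trans H (ltnW (NP (g j)).1).
have g_ltg i j : (i < j)%N -> (g i < g j)%N.
  by move/g_lt; apply: leq_trans; have [] := NP (g i).
(* Finite joins start from [\bot], whose image under [f] may be non-empty. *)
have y_bot n : y n \notin f \bot.
  apply/negP => y0; have /negP := yJ _ _ (ltnSn n) _ (xJ n.+1); apply.
  have : f \bot <= f (x n.+1) by rewrite f_mono le0x.
  by move/fset_leP; apply.
have y_priv i j : i != j -> y (g i) \notin f (x (g j)).
  rewrite neq_ltn => /orP[/g_ltg ij|/g_lt ji]; first exact: yJ ij _ (xJ _).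
  by have [_] := NP (g j); apply.
pose h (F : {fset nat}) : P := \join_(k <- F) x (g k).
have h_mono : {mono h : F G / F <= G}.
  move=> F G; apply/idP/idP => [|/fset_leP FG].
    move=> hFG; apply/fset_leP => k kF; apply/negPn/negP => kG.
    have : y (g k) \notin f (h G).
      apply: (@notin_join _ G (x \o g)) (y_bot _) _ => i iG.
      by apply: y_priv; apply: contraNneq kG => ->.
    move/negP; apply.
    have : f (x (g k)) <= f (h G).
      by rewrite f_mono (le_trans _ hFG) // (joins_sup_seq (x \o g) kF).
    by move/fset_leP; apply; apply: yx.
  apply/joinsP_seq => k kF _.
  exact: (joins_sup_seq (x \o g) (FG _ kF)).
have h_join F G : h (F `|` G)%fset = Order.join (h F) (h G).
  apply/eqP; rewrite eq_le leUx !h_mono; apply/and3P; split.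
  - apply/joinsP_seq => k; rewrite in_fsetU => /orP[] kFG _.
      by rewrite (le_trans _ (leUl _ _)) // (joins_sup_seq (x \o g) kFG).
    by rewrite (le_trans _ (leUr _ _)) // (joins_sup_seq (x \o g) kFG).
  - by apply/fset_leP => k; rewrite in_fsetU => ->.
  - by apply/fset_leP => k; rewrite in_fsetU => ->; rewrite orbT.
exists (range h); split.
  by move=> _ _ [F _ <-] [G _ <-]; exists (F `|` G)%fset.
exists h; split; last by move=> F G _ _; apply: h_mono.
by split=> // F G _ _ hE; apply/eqP; rewrite eq_le -!h_mono hE !lexx.
Qed.

End JoinEmbeddingInFiniteSets.

(** * A criterion for containing the chain of initial segments *)

Section Representation.
Variables (d : Order.disp_t) (T : orderType d) (e : T -> nat).
Hypothesis e_inj : injective e.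

(** An initial segment [I] is sent to the ideal of those [p] whose points are all labels of elements
    of [I]. The last hypothesis supplies, for each [t], a [p] that belongs to this ideal exactly
    when [t] is in [I], so inclusions are reflected. The condition on [\bot] keeps the ideal
    non-empty even for empty [I]. *)
Lemma in_J_of_representation d' (P : bJoinSemilatticeType d')
    (f : P -> {fset nat}) :
  {mono f : x y / x <= y} -> {morph f : x y / Order.join x y >-> x `|` y}%fset ->
  f \bot = fset0 ->
  (forall t, exists p, e t \in f p /\
     forall a, a \in f p -> exists2 s, s <= t & a = e s) ->
  in_J T P.
Proof.
move=> f_mono f_join f_bot princ.
pose F (I : set T) : set P := [set p | forall a, a \in f p -> (e @` I) a].
have F_mono (I I' : set T) : initial_segment I -> F I `<=` F I' <-> I `<=` I'.
  move=> Ii; split=> [FF t It|II' p Fp a /Fp[s Is <-]]; last first.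
    by exists s => //; apply: II'.
  have [p [tp Hp]] := princ t.
  have [s I's /e_inj <- //] : (e @` I') (e t).
    apply: FF tp => a /Hp[s st ->]; exists s => //; exact: Ii It st.
exists (F @` initial_segments T); split.
- move=> _ [I Ii <-]; split.
  + by exists \bot => a; rewrite f_bot in_fset0.
  + move=> p q Fp Fq; exists (Order.join p q); split; rewrite ?leUl ?leUr //.
    by move=> a; rewrite f_join in_fsetU => /orP[/Fp|/Fq].
  + move=> p q Fq; rewrite -f_mono => /fset_leP pq a /pq; exact: Fq.
- move=> _ _ [I Ii <-] [I' Ii' <-]; rewrite !subsetOE !F_mono //.
  have [II'|] := pselect (I `<=` I'); first by left.
  move=> nII'; right=> t I't; apply: contrapT => nIt; apply: nII' => s Is.
  have [/Ii' |ts] := leP s t; first exact.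
  by case: nIt; apply: Ii Is (ltW ts).
- exists F; split.
    split=> [I Ii|I I' /set_mem Ii /set_mem Ii' FE|//]; first by exists I.
    by apply/seteqP; split; apply/F_mono; rewrite ?FE.
  move=> I I' /set_mem Ii /set_mem Ii'.
  by apply/idP/idP; rewrite !subsetOE F_mono.
Qed.

Lemma finite_subsets_omega_in_J : in_J T finite_subsets_omega.
Proof.
apply: (@in_J_of_representation _ finite_subsets_omega id) => // t.
exists [fset e t]%fset; split; first by rewrite in_fset1.
by move=> a; rewrite in_fset1 => /eqP->; exists t.
Qed.

End Representation.

(** * Finite initial segments of the sierpinskization *)

Section Sierpinskization.
Variables (d : Order.disp_t) (T : orderType d) (e : T -> nat).

(** Elements of the chain are coded by their labels, so that the semilattice lies inside
    [{fset nat}], with union as join. *)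
Definition sierpinski_closed : {pred {fset nat}} := fun A =>
  `[< forall a, a \in A -> exists2 t, a = e t &
        forall s, s <= t -> (e s <= e t)%N -> e s \in A >].

Definition sierpinski_downset := {A : {fset nat} | sierpinski_closed A}.

HB.instance Definition _ := SubChoice.on sierpinski_downset.
HB.instance Definition _ :=
  [SubChoice_isSubPOrder of sierpinski_downset by <: with fset_incl_display].

Lemma sierpinski_closedU A B : sierpinski_closed A -> sierpinski_closed B ->
  sierpinski_closed (A `|` B)%fset.
Proof.
move=> /asboolP cA /asboolP cB; apply/asboolP => a.
rewrite in_fsetU => /orP[/cA|/cB] [t -> tP]; exists t => // s st est;
  by rewrite in_fsetU tP ?orbT.
Qed.

Lemma sierpinski_closed0 : sierpinski_closed fset0.
Proof. by apply/asboolP => a; rewrite in_fset0. Qed.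

Definition sierpinski_join (p q : sierpinski_downset) : sierpinski_downset :=
  exist _ (val p `|` val q)%fset (sierpinski_closedU (valP p) (valP q)).

Fact sierpinski_leUx p q r :
  (sierpinski_join p q <= r) = (p <= r) && (q <= r).
Proof. exact: fsubUset. Qed.

HB.instance Definition _ :=
  Order.POrder_isJoinSemilattice.Build fset_incl_display sierpinski_downset
    sierpinski_leUx.

Definition sierpinski_bot : sierpinski_downset :=
  exist _ fset0 sierpinski_closed0.

Fact sierpinski_le0x p : sierpinski_bot <= p.
Proof. exact: fsub0set. Qed.

HB.instance Definition _ :=
  Order.hasBottom.Build fset_incl_display sierpinski_downset sierpinski_le0x.

Lemma sierpinski_embeds : embeds sierpinski_downset finite_subsets_omega.
Proof.
exists (range (val : sierpinski_downset -> _)); split.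
  by move=> _ _ [p _ <-] [q _ <-]; exists (Order.join p q).
exists val; split=> //; split=> [p _|p q _ _ /val_inj|//]; last exact.
by exists p.
Qed.

Hypothesis e_inj : injective e.

Lemma sierpinski_in_J : in_J T sierpinski_downset.
Proof.
apply: (@in_J_of_representation _ T e e_inj _ _
  (val : sierpinski_downset -> _)) => // t.
(* The principal initial segment of [t] in the sierpinskization; the bound [e t] on labels makes it
   finite. *)
pose A := [fset a in iota 0 (e t).+1 | `[< exists2 s, s <= t & a = e s >]]%fset.
have AP a : a \in A <-> (a <= e t)%N /\ exists2 s, s <= t & a = e s.
  rewrite in_fset inE (mem_iota 0) add0n ltnS /=.
  by split=> [/andP[-> /asboolP]|[-> /asboolP]].
have cA : sierpinski_closed A.
  apply/asboolP => a /AP[ae [s st aE]]; exists s => // r rs ers; apply/AP.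
  split; first by apply: leq_trans ers _; rewrite -aE.
  by exists r => //; apply: le_trans rs st.
exists (exist _ A cA); split=> /=; first by apply/AP; split=> //; exists t.
by move=> a /AP[].
Qed.

Lemma ordinal_not_embeds_sierpinski : is_ordinal T ->
  ~ embeds finite_subsets_omega sierpinski_downset.
Proof.
move=> woT [S [Sj [g [gb gm]]]].
have [{}gm gj] := order_isomorphic_join Sj gb gm.
(* The finite sets of integers at least [n] form strictly decreasing ideals, separated by the
   singletons of [n]. *)
pose J n : set finite_subsets_omega := [set F | forall k, k \in F -> (n <= k)%N].
have [||n||x [y [xJ yx yI yJ]]] := @private_points _ _ (val \o g) _ J.
- by move=> F G /=; rewrite -[LHS]/(g F <= g G) gm.
- move=> n; split; first by exists fset0.
  + move=> F G JF JG; exists (F `|` G)%fset; split.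
    * by move=> k; rewrite in_fsetU => /orP[/JF|/JG].
    * by apply/fset_leP => k; rewrite in_fsetU => ->.
    * by apply/fset_leP => k; rewrite in_fsetU => ->; rewrite orbT.
  + by move=> F G JG /fset_leP FG k /FG; apply: JG.
- by move=> F JF k /JF /ltnW.
- move=> n /(_ [fset n]%fset) H; have : J n [fset n]%fset.
    by move=> k; rewrite in_fset1 => /eqP->.
  by move/H => /(_ n); rewrite in_fset1 eqxx ltnn; case/(_ isT)/notF.
have yclosed n : exists2 t, y n = e t &
    forall s, s <= t -> (e s <= e t)%N -> e s \in val (g (x n)).
  by have /asboolP := valP (g (x n)); apply; apply: yx.
have /choice[t tP] : forall n, exists t, y n = e t /\
    forall s, s <= t -> (e s <= e t)%N -> e s \in val (g (x n)).
  by move=> n; have [t] := yclosed n; exists t.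
(* Take [m] with [t m] least. By injectivity some [n > m] has [y n >= y m]; then [t m] is below
   [t n] in both orders, and closedness puts [y m] in the image of [x n], against privacy. *)
have [|m0 [[/asboolP[m mE] mmin] _]] := woT [pred u | `[< exists n, t n = u >]].
  by exists (t 0%N); apply/asboolP; exists 0%N.
have [N NP] := injective_seq_escapes (iota 0 (y m)) yI.
pose n := maxn N m.+1; have mn : (m < n)%N by rewrite leq_max leqnn orbT.
have /negP := NP n (leq_maxl _ _); apply; rewrite mem_iota add0n /= ltnNge.
apply/negP => ymn; have /negP := yJ _ _ mn _ (xJ n); apply.
have [ynE tnP] := tP n; have [ymE _] := tP m; rewrite /= ymE; apply: tnP.
  by rewrite mE; apply: mmin; apply/asboolP; exists n.
by rewrite -ymE -ynE.
Qed.

End Sierpinskization.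

(** * Descending sequences and the equivalence *)

Lemma not_ordinal_decreasing d (T : orderType d) : ~ is_ordinal T ->
  exists t : nat -> T, forall n, t n.+1 < t n.
Proof.
move=> nwo; have [A [[a0 Aa0] Amin]] : exists A : {pred T},
    wochoice.nonempty A /\ forall x, x \in A -> exists y, y \in A /\ y < x.
  apply: contrapT => H; apply: nwo; apply: wochoice.antisymmetric_well_order.
    exact: le_anti.
  move=> A A0; apply: contrapT => nmin; apply: H; exists A; split=> // x Ax.
  apply: contrapT => nlt; apply: nmin; exists x; split=> // y Ay.
  by rewrite leNgt; apply/negP => yx; apply: nlt; exists y.
have /choice[h hP] : forall x, exists y, x \in A -> y \in A /\ y < x.
  move=> x; have [/Amin[y yP]|_] := boolP (x \in A); first by exists y.
  by exists x.
have hA n : iter n h a0 \in A by elim: n => //= n /hP[].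
by exists (fun n => iter n h a0) => n; have [] := hP _ (hA n).
Qed.

Theorem mainTheorem4 (d : Order.disp_t) (T : orderType d)
    (countT : countable [set: T]%classic) :
  minimal_in_J T finite_subsets_omega <-> ~ is_ordinal T.
Proof.
have /countable_injP[e e_inj'] := countT.
have e_inj : injective e by move=> s t; apply: e_inj'; rewrite in_setT.
split=> [[_ Mmin] woT|nwo].
  apply: (ordinal_not_embeds_sierpinski (e := e) woT).
  exact: Mmin (sierpinski_in_J e_inj) (sierpinski_embeds e).
split; first exact: finite_subsets_omega_in_J e_inj.
move=> d' P [C [Cid _ [F [[FC _ _] Fm]]]] [S [Sj [f [fb fm]]]].
have [{}fm fj] := order_isomorphic_join Sj fb fm.
have [t tdecr] := not_ordinal_decreasing nwo.
(* Principal initial segments of a descending sequence decrease strictly, and [F] carries this over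
   to the ideals of [P]. *)
pose I n : set T := [set s | s <= t n].
have Ii n : initial_segments T (I n) by move=> r s st rs; apply: le_trans rs st.
have Fsub m n : F (I m) `<=` F (I n) <-> I m `<=` I n.
  by rewrite -!subsetOE Fm // inE.
apply: (@finite_subsets_omega_embeds _ P f fm fj (F \o I)) => /=.
- by move=> n; apply/Cid/FC.
- by move=> n; apply/Fsub => s; rewrite /I /= => /le_trans; apply; apply: ltW.
- by move=> n /Fsub /(_ (t n) (lexx _)); rewrite /I /= leNgt tdecr.
Qed.
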